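(* Let $\varphi\in[0,2\pi)$ and $\kappa\in\{1,2,\dots\}$, and let $P(z_1,\dots,z_\kappa)\in\mathbb{C}^{n,n}[z_1,\dots,z_\kappa]$ be hyperstable with respect to $H_\varphi^\kappa$. Then each of the following transformations maps $P$ to a matrix polynomial that is hyperstable with respect to the Cartesian power of $H_\varphi$ corresponding to its set of variables: (i) Permutation: $P(z_1,\dots,z_\kappa)\mapsto P(z_{\sigma(1)},\dots,z_{\sigma(\kappa)})$, for every permutation $\sigma\in S_\kappa$ (hyperstable with respect to $H_\varphi^\kappa$). (ii) Scaling: $P(z_1,\dots,z_\kappa)\mapsto P(z_1,\dots,z_{j-1},az_j,z_{j+1},\dots,z_\kappa)$, for every $j\in\{1,\dots,\kappa\}$ and every real $a>0$ (hyperstable with respect to $H_\varphi^\kappa$). (iii) Diagonalization: $P(z_1,\dots,z_\kappa)\mapsto P(z_j,z_j,\dots,z_j,z_{j+1},\dots,z_\kappa)\in\mathbb{C}^{n,n}[z_j,z_{j+1},\dots,z_\kappa]$, for every $j\in\{1,\dots,\kappa\}$, where the first $j$ arguments are all replaced by $z_j$ (hyperstable with respect to $H_\varphi^{\kappa-j+1}$). (iv) Inversion with rotation: $P(z_1,\dots,z_\kappa)\mapsto z_j^dP(z_1,\dots,z_{j-1},-e^{-2\mathrm{i}\varphi}/z_j,z_{j+1},\dots,z_\kappa)$, for every $j\in\{1,\dots,\kappa\}$, where $d$ is the degree of $P$ with respect to $z_j$ (hyperstable with respect to $H_\varphi^\kappa$). (v) Specialization: for $\kappa\geq2$, $P(z_1,\dots,z_\kappa)\mapsto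 P(z_1,\dots,z_{j-1},a,z_{j+1},\dots,z_\kappa)\in\mathbb{C}^{n,n}[z_1,\dots,z_{j-1},z_{j+1},\dots,z_\kappa]$, for every $j\in\{1,\dots,\kappa\}$ and every $a\in H_\varphi$ (hyperstable with respect to $H_\varphi^{\kappa-1}$). Furthermore, for $j\in\{1,\dots,\kappa\}$, the partial derivative $\frac{\partial P}{\partial z_j}(z_1,\dots,z_\kappa)$ is hyperstable with respect to $H_\varphi^\kappa$, provided that the entries of $\frac{\partial P}{\partial z_j}(z_1,\dots,z_\kappa)$ are linearly independent polynomials over $\mathbb{C}$.
   Context: $H_\varphi:=\{\lambda\in\mathbb{C}:\operatorname{Im}(\lambda e^{\mathrm{i}\varphi})>0\}$ and $H_\varphi^m$ is its $m$-th Cartesian power. A matrix polynomial $Q(z_1,\dots,z_m)\in\mathbb{C}^{n,n}[z_1,\dots,z_m]$ is hyperstable with respect to a nonempty open or closed set $\Omega\subseteq\mathbb{C}^m$ if for every $x\in\mathbb{C}^n\setminus\{0\}$ there exists $y\in\mathbb{C}^n\setminus\{0\}$ such that $y^*Q(w_1,\dots,w_m)x\neq0$ for all $(w_1,\dots,w_m)\in\Omega$. Linear independence of the entries means that the family of the $n^2$ scalar entries is linearly independent in the complex vector space $\mathbb{C}[z_1,\dots,z_\kappa]$. *)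

(* Defs.v *)
From HB Require Import structures.
From mathcomp Require Import all_boot all_order all_algebra all_fingroup.
From mathcomp Require Import classical_sets reals.
From mathcomp Require Import complex mpoly.
(* Not imported: the notations of trigo's dependencies clash with mpoly's. *)
From mathcomp Require trigo.

Set Implicit Arguments.
Unset Strict Implicit.
Unset Printing Implicit Defensive.

Import Order.TTheory GRing.Theory Num.Theory.
Local Open Scope ring_scope.
Local Open Scope complex_scope.
Local Open Scope sesquilinear_scope.
Local Open Scope classical_set_scope.

Definition expi (R : realType) (t : R) : R[i] := trigo.cos t +i* trigo.sin t.

Definition halfplane (R : realType) (phi : R) : set R[i] :=
  [set z | 0 < complex.Im (z * expi phi)].

Definition halfplane_pow (R : realType) (phi : R) (m : nat) :
    set ('I_m -> R[i]) :=
  [set w | forall i, halfplane phi (w i)].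
Arguments halfplane_pow {R} phi m w.

Definition mxmeval (C : comNzRingType) (m n : nat) (w : 'I_m -> C)
    (Q : 'M[{mpoly C[m]}]_n) : 'M[C]_n :=
  map_mx (meval w) Q.

(* Omega is meant to be nonempty and open or closed; halfplane_pow is nonempty
   and open.  The witness y may depend on x but not on the point w. *)
Definition hyperstable (R : realType) (m n : nat) (Omega : set ('I_m -> R[i]))
    (Q : 'M[{mpoly R[i][m]}]_n) : Prop :=
  forall x : 'cV[R[i]]_n, x != 0 ->
  exists2 y : 'cV[R[i]]_n, y != 0 &
    forall w, Omega w -> (y ^t* *m mxmeval w Q *m x) 0 0 != 0.

(* Substitution of the polynomial s i for the i-th variable. *)
Definition mxsubst (C : comNzRingType) (k l n : nat)
    (s : 'I_k -> {mpoly C[l]}) (P : 'M[{mpoly C[k]}]_n) : 'M[{mpoly C[l]}]_n :=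
  map_mx (comp_mpoly [tuple s i | i < k]) P.

Definition permute_vars (C : comNzRingType) (k n : nat) (s : 'S_k)
    (P : 'M[{mpoly C[k]}]_n) : 'M[{mpoly C[k]}]_n :=
  mxsubst (fun i => 'X_(s i)) P.

Definition scale_var (C : comNzRingType) (k n : nat) (j : 'I_k) (a : C)
    (P : 'M[{mpoly C[k]}]_n) : 'M[{mpoly C[k]}]_n :=
  mxsubst (fun i => if i == j then a *: 'X_i else 'X_i) P.

(* The variables with indices j, ..., k.-1 (counted from 0) are renumbered
   0, ..., k - j - 1; the truncated subtraction sends the indices 0, ..., j
   to 0. *)
Lemma diag_index_subproof (k : nat) (j i : 'I_k) : (i - j < k - j)%N.
Proof.
have [le_ji|/ltnW le_ij] := leqP j i; first exact: ltn_sub2r.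
by rewrite (eqP le_ij) subn_gt0.
Qed.

Definition diag_index (k : nat) (j i : 'I_k) : 'I_(k - j) :=
  Ordinal (diag_index_subproof j i).

Definition diagonalize (C : comNzRingType) (k n : nat) (j : 'I_k)
    (P : 'M[{mpoly C[k]}]_n) : 'M[{mpoly C[k - j]}]_n :=
  mxsubst (fun i => 'X_(diag_index j i)) P.

(* The remaining variables are renumbered in increasing order. *)
Definition specialize (C : comNzRingType) (k n : nat) (j : 'I_k) (a : C)
    (P : 'M[{mpoly C[k]}]_n) : 'M[{mpoly C[k.-1]}]_n :=
  mxsubst (fun i => if unlift j i is Some i' then 'X_i' else a%:MP) P.

Definition deg_in (C : comNzRingType) (k : nat) (j : 'I_k)
    (p : {mpoly C[k]}) : nat :=
  \max_(m <- msupp p) m j.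

Definition mxdeg_in (C : comNzRingType) (k n : nat) (j : 'I_k)
    (P : 'M[{mpoly C[k]}]_n) : nat :=
  \max_(r < n) \max_(c < n) deg_in j (P r c).

(* z_j ^ d * p(z_0, ..., b / z_j, ..., z_{k-1}), for d >= deg_in j p: the
   exponent e of z_j becomes d - e, with the factor b ^ e. *)
Definition invert_var (C : comNzRingType) (k : nat) (j : 'I_k) (b : C)
    (d : nat) (p : {mpoly C[k]}) : {mpoly C[k]} :=
  \sum_(m <- msupp p)
    (p@_m * b ^+ m j) *:
      'X_[[multinom (if i == j then d - m i else m i)%N | i < k]].

Lemma meval_invert_var (C : fieldType) (k : nat) (j : 'I_k) (b : C) (d : nat)
    (p : {mpoly C[k]}) (z : 'I_k -> C) :
  (deg_in j p <= d)%N -> z j != 0 ->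
  meval z (invert_var j b d p) =
  z j ^+ d * meval (fun i => if i == j then b / z j else z i) p.
Proof.
move=> le_d zj0; rewrite /invert_var raddf_sum [in RHS]mevalE mulr_sumr.
rewrite big_seq [RHS]big_seq; apply: eq_bigr => m m_p.
have le_md : (m j <= d)%N.
  by apply: leq_trans le_d; rewrite /deg_in (big_rem m) //= leq_maxl.
rewrite /= mevalZ mevalX -!mulrA [RHS]mulrCA; congr (_ * _).
rewrite (bigD1 j) //= [X in z j ^+ d * X](bigD1 j) //= mnmE eqxx.
have -> : \prod_(i < k | i != j)
    z i ^+ [multinom (if i == j then d - m i else m i)%N | i < k] i =
  \prod_(i < k | i != j) (if i == j then b / z j else z i) ^+ m i.
  by apply: eq_bigr => i /negPf ne_ij; rewrite mnmE ne_ij.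
rewrite !mulrA; congr (_ * _).
rewrite -[in RHS](subnK le_md) exprD expr_div_n -mulrA mulrC.
by congr (_ * _); rewrite [RHS]mulrC divfK // expf_neq0.
Qed.

Definition invert_rotate (R : realType) (phi : R) (k n : nat) (j : 'I_k)
    (P : 'M[{mpoly R[i][k]}]_n) : 'M[{mpoly R[i][k]}]_n :=
  map_mx (invert_var j (- expi (- (2 * phi))) (mxdeg_in j P)) P.

Lemma mxmeval_invert_rotate (R : realType) (phi : R) (k n : nat) (j : 'I_k)
    (P : 'M[{mpoly R[i][k]}]_n) (z : 'I_k -> R[i]) :
  z j != 0 ->
  mxmeval z (invert_rotate phi j P) =
  z j ^+ mxdeg_in j P *:
    mxmeval (fun i => if i == j then - expi (- (2 * phi)) / z j else z i) P.
Proof.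
move=> zj0; apply/matrixP => r c; rewrite !mxE meval_invert_var //.
apply: leq_trans (leq_bigmax r); exact: leq_bigmax (c : 'I_n).
Qed.

Definition mxderiv (C : comNzRingType) (k n : nat) (j : 'I_k)
    (P : 'M[{mpoly C[k]}]_n) : 'M[{mpoly C[k]}]_n :=
  map_mx (mderiv j) P.

Definition lin_indep_entries (C : comNzRingType) (k n : nat)
    (Q : 'M[{mpoly C[k]}]_n) : Prop :=
  forall c : 'M[C]_n,
    \sum_(r < n) \sum_(s < n) c r s *: Q r s = 0 -> c = 0.

(* Main.v *)
(* Substitutions and inversion keep the arguments inside the half-plane, so the
   witness y is unchanged.  For the derivative, let p = y^* P x, which has no
   zero in H^k, and u = e^{i phi}.  Decomposing d_j p / p into the partial
   fractions 1 / (z_j - r), whose roots r lie outside H, gives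
   Im (conj(u) d_j p / p) <= 0 on H^k.  By the open mapping property along
   complex lines, d_j p / p can vanish at a point of H^k only if d_j p is the
   zero polynomial, which linear independence of the entries excludes.  This
   avoids Hurwitz's theorem when the degree in z_j drops. *)
Require Import Defs.
From HB Require Import structures.
From mathcomp Require Import all_boot all_order all_algebra all_fingroup.
From mathcomp Require Import classical_sets reals.
From mathcomp Require Import complex mpoly ring lra.
From mathcomp Require trigo.

Set Implicit Arguments.
Unset Strict Implicit.
Unset Printing Implicit Defensive.

Import Order.TTheory GRing.Theory Num.Theory.
Local Open Scope ring_scope.
Local Open Scope complex_scope.

(* Otherwise [^*] is [conjc] or [Num.conj] according to the surrounding scope. *)
Local Notation "z ^*" := (Num.conj z) : complex_scope.

(** * Restriction of a multivariate polynomial to a complex line *)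

Section LineRestriction.
Variables (C : comNzRingType) (k : nat).
Implicit Types (w v : 'I_k -> C) (p q : {mpoly C[k]}).

Definition line_poly w v p : {poly C} :=
  mmap (@polyC C) (fun i => (w i)%:P + v i *: 'X) p.

Lemma horner_line_poly w v p s :
  (line_poly w v p).[s] = p.@[fun i => w i + s * v i].
Proof.
rewrite mevalE /line_poly /mmap horner_sum; apply: eq_bigr => m _.
rewrite hornerCM /mmap1 horner_prod; congr (_ * _); apply: eq_bigr => i _.
by rewrite !hornerE /= mulrC.
Qed.

(** Chain rule along a coordinate axis: [D] holds for constants and variables and passes to products
    and sums. *)
Lemma deriv_line_poly w j p :
  (line_poly w (fun i => (i == j)%:R) p)^`() =
  line_poly w (fun i => (i == j)%:R) p^`M(j).
Proof.
set v := (X in line_poly w X); rewrite /line_poly.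
pose D q := (line_poly w v q)^`() = line_poly w v q^`M(j).
rewrite -/(D p).
have DM q r : D q -> D r -> D (q * r).
  rewrite /D /line_poly => Dq Dr.
  by rewrite mderivM !rmorphM derivM Dq Dr rmorphD !rmorphM.
have DC c : D c%:MP.
  by rewrite /D /line_poly mderivC rmorph0 mmapC derivC.
have DX i : D 'X_i.
  rewrite /D /line_poly mderivX mmapX mmap1U mmapZ mmapX.
  rewrite derivD derivC derivZ derivX add0r mnm1E /v /=.
  rewrite alg_polyC; case: eqVneq => [->|_]; last by rewrite mul0r.
  have -> : (U_(j) - U_(j) = 0 :> 'X_{1..k})%MM.
    by apply/mnmP => l; rewrite mnmBE subnn mnm0E.
  by rewrite mmap11 mulr1.
elim/mpolyind: p => [|c m p _ _ Dp]; first by rewrite -mpolyC0; apply: DC.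
have D1 : D (c *: 'X_[m]).
  rewrite -mul_mpolyC; apply: (DM) => //; rewrite mpolyXE_id.
  elim/big_rec: _ => [|i x _ Dx]; first by rewrite -mpolyC1.
  apply/DM/Dx => {x Dx}; elim: (m i) => [|e De]; first by rewrite expr0 -mpolyC1.
  by rewrite exprS; apply/DM/De.
move: D1 Dp; rewrite /D /line_poly => D1 Dp.
by rewrite mderivD !rmorphD /= derivD D1 Dp.
Qed.

End LineRestriction.

(** * Polynomials that vanish at every point *)

Lemma poly_horner_eq0 (F : numDomainType) (q : {poly F}) :
  (forall s, q.[s] = 0) -> q = 0.
Proof.
move=> q0; apply/eqP; apply: contraT => nz.
pose rs := [seq (i%:R : F) | i <- iota 0 (size q)].
have: (size rs < size q)%N.
  apply: max_poly_roots nz _ _; first by apply/allP => x _; apply/rootP.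
  by rewrite map_inj_uniq ?iota_uniq //; apply: mulrIn; rewrite oner_eq0.
by rewrite size_map size_iota ltnn.
Qed.

(* A polynomial function that vanishes has vanishing partial derivatives, so
   all the Taylor coefficients at the origin vanish. *)
Lemma meval_inj0 (F : numDomainType) (k : nat) (p : {mpoly F[k]}) :
  (forall w, p.@[w] = 0) -> p = 0.
Proof.
suff H d m (q : {mpoly F[k]}) :
    mdeg m = d -> (forall w, q.@[w] = 0) -> q@_m = 0.
  by move=> p0; apply/mpolyP => m; rewrite mcoeff0; apply: (H (mdeg m)).
elim: d m q => [|d IH] m q dm q0.
  move/eqP: dm; rewrite mdeg_eq0 => /eqP ->.
  have := q0 (fun=> 0); rewrite mevalE.
  case: (boolP (0%MM \in msupp q)) => [m0|/memN_msupp_eq0 -> //].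
  rewrite (bigD1_seq 0%MM) //= [X in _ * X]big1 ?mulr1; last first.
    by move=> i _; rewrite mnm0E.
  rewrite big1 ?addr0 // => m' nz.
  have [i mi] : exists i, m' i != 0%N.
    apply/existsP; apply: contraNT nz; rewrite negb_exists => /forallP z.
    by apply/eqP/mnmP => i; rewrite mnm0E; apply/eqP; have := z i; rewrite negbK.
  by rewrite (bigD1 i) //= expr0n (negPf mi) mul0r mulr0.
have [i mi] : exists i, m i != 0%N.
  apply/existsP; apply: contraPT dm; rewrite negb_exists => /forallP z.
  suff -> : m = 0%MM by rewrite mdeg0.
  by apply/mnmP => i; rewrite mnm0E; apply/eqP; have := z i; rewrite negbK.
have mE : (m - U_(i) + U_(i))%MM = m by rewrite submK // lep1mP.
have dm' : mdeg (m - U_(i))%MM = d.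
  by move: dm; rewrite -{1}mE mdegD mdeg1 addn1 => -[].
have /(IH _ _ dm') : forall w, (q^`M(i)).@[w] = 0.
  move=> w; pose v l : F := (l == i)%:R.
  have -> : (q^`M(i)).@[w] = (line_poly w v q^`M(i)).[0].
    by rewrite horner_line_poly; apply: meval_eq => l; rewrite mul0r addr0.
  rewrite -deriv_line_poly.
  suff -> : line_poly w v q = 0 by rewrite deriv0 horner0.
  apply: poly_horner_eq0 => s; by rewrite horner_line_poly.
(* This coefficient is that of [q] at [m] times a positive integer, which cancels in characteristic
   zero. *)
rewrite mcoeff_mderiv mE => /eqP.
by rewrite mulrn_eq0 /= => /eqP.
Qed.

(** * Sign estimates for imaginary parts *)

Section HalfPlane.
Variable R : realType.
Implicit Types (u z s : R[i]) (q : {poly R[i]}).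
Local Notation im := (@complex.Im R).

Lemma Im_mul_conj z s :
  im (z * z^* * s) = (complex.Re z ^+ 2 + im z ^+ 2) * im s.
Proof. by case: z s => a b [c d] /=; ring. Qed.

Lemma normsq_gt0 z : z != 0 -> 0 < complex.Re z ^+ 2 + im z ^+ 2.
Proof.
move=> z0; rewrite lt0r addr_ge0 ?sqr_ge0 // andbT paddr_eq0 ?sqr_ge0 //.
by move: z0; rewrite !sqrf_eq0 eq_complex.
Qed.

(* Each root r contributes 1 / (t - r) to q' / q, and t - r lies in the
   half-plane; multiplying by |q(t)|^2 avoids the division. *)
Lemma Im_log_deriv u q t :
  0 < im (t * u) -> (forall s, 0 < im (s * u) -> q.[s] != 0) ->
  im (u^* * (q^`().[t] * (q.[t])^*)) <= 0.
Proof.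
move=> Ht; have [rs ->] := closed_field_poly_normal q.
set c := lead_coef q => nz.
have {nz} Hr : all (fun r => im (r * u) <= 0) rs.
  apply/allP => r r_rs; rewrite leNgt; apply/negP => /nz.
  by rewrite hornerZ (rootP _) ?mulr0 ?eqxx // root_prod_XsubC.
rewrite derivZ !hornerZ rmorphM.
set q1 := \prod_(z <- rs) _.
have -> : u^* * (c * q1^`().[t] * (c^* * (q1.[t])^*)) =
  c * c^* * (u^* * (q1^`().[t] * (q1.[t])^*)) by ring.
rewrite Im_mul_conj mulr_ge0_le0 ?addr_ge0 ?sqr_ge0 // {c}/q1.
elim: rs Hr => [_|r rs IH /andP[rle /IH {}IH]].
  by rewrite big_nil -polyC1 derivC horner0 mul0r mulr0.
rewrite big_cons; move: IH; set q1 := \prod_(z <- rs) _ => IH.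
rewrite derivM derivXsubC mul1r hornerD !hornerM hornerXsubC rmorphM /=.
(* The root [r] contributes |q1(t)|^2 times the conjugate of (t - r) u; the other roots contribute
   |t - r|^2 times the quantity of the induction hypothesis. *)
have -> : u^* * ((q1.[t] + (t - r) * q1^`().[t]) * ((t - r)^* * (q1.[t])^*)) =
  q1.[t] * (q1.[t])^* * ((t - r) * u)^* +
  (t - r) * (t - r)^* * (u^* * (q1^`().[t] * (q1.[t])^*)).
  have -> : ((t - r) * u)^* = (t - r)^* * u^* by rewrite -rmorphM.
  by ring.
rewrite raddfD /= !Im_mul_conj.
have ImC z : im z^* = - im z by case: z.
rewrite ImC mulrBl raddfB /= opprB -[leRHS]addr0 lerD //.
  by rewrite mulr_ge0_le0 ?addr_ge0 ?sqr_ge0 // subr_le0 (le_trans rle) // ltW.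
by rewrite mulr_ge0_le0 // addr_ge0 ?sqr_ge0.
Qed.

(** Continuity at 0 along the positive reals, made explicit by splitting off the constant term and
    bounding the cofactor of X on (0, 1]. *)
Lemma Im_horner_near0 q :
  0 < im q.[0] ->
  exists2 d : R, 0 < d & forall r : R, 0 < r <= d -> 0 < im q.[r%:C].
Proof.
elim/poly_ind: q => [|q c _]; first by rewrite horner0 ltxx.
rewrite hornerMXaddC mulr0 add0r => c0.
have [M M0 HM] : exists2 M : R, 0 < M &
    forall r : R, 0 < r <= 1 -> - im q.[r%:C] <= M.
  elim/poly_ind: q {c0} => [|q b [M M0 IH]].
    by exists 1 => // r _; rewrite horner0 oppr0.
  exists (M + `|im b|) => [|r /[dup] /IH {}IH /andP[r0 r1]].
    by rewrite ltr_pwDl.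
  rewrite hornerMXaddC raddfD /= opprD lerD //; last first.
    by rewrite (le_trans (ler_norm _)) // normrN.
  have -> : im (q.[r%:C] * r%:C) = r * im q.[r%:C].
    by case: (q.[_]) => x y /=; ring.
  rewrite -mulrN (le_trans (ler_wpM2l (ltW r0) IH)) //.
  by rewrite ler_piMl // ltW.
(* Below this radius the non-constant part lowers the imaginary part by at most half of [im c]. *)
exists (Num.min 1 (im c / (2 * M))) => [|r /andP[r0]].
  by rewrite lt_min ltr01 /= divr_gt0 // mulr_gt0.
rewrite le_min => /andP[r1]; rewrite ler_pdivlMr ?mulr_gt0 // => rM.
rewrite hornerMXaddC raddfD /=.
have -> : im (q.[r%:C] * r%:C) = r * im q.[r%:C].
  by case: (q.[_]) => x y /=; ring.
have := HM r; rewrite r0 r1 => /(_ isT) /(ler_wpM2l (ltW r0)).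
by rewrite mulrN; move: rM; rewrite mulrCA; lra.
Qed.

Lemma Im_horner_near0_all (I : finType) (q : I -> {poly R[i]}) :
  (forall i, 0 < im (q i).[0]) ->
  exists2 d : R, 0 < d & forall i (r : R), 0 < r <= d -> 0 < im (q i).[r%:C].
Proof.
move=> q0.
suff [d d0 H] : exists2 d : R, 0 < d &
    forall i, i \in enum I -> forall r : R, 0 < r <= d -> 0 < im (q i).[r%:C].
  by exists d => // i; apply: H; rewrite mem_enum.
elim: (enum I) => [|i s [d d0 IH]]; first by exists 1.
have [e e0 He] := Im_horner_near0 (q0 i).
exists (Num.min d e) => [|l]; first by rewrite lt_min d0.
rewrite inE => /predU1P[->|/IH {}IH] r; rewrite le_min => /and3P[r0 rd re].
  by apply: He; rewrite r0.
by apply: IH; rewrite r0.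
Qed.

End HalfPlane.

(** * Partial derivatives of stable scalar polynomials *)

Section Stability.
Variable R : realType.
Local Notation im := (@complex.Im R).

(* On the line w0 + s v write p_j = s^e A1(s) with A1(0) != 0.  The choice of z
   makes s = r z turn the quantity of [Im_log_deriv] into approximately r^e * i
   for small r > 0, contradicting its sign. *)
Lemma stable_mderiv (u : R[i]) (k : nat) (j : 'I_k) (p : {mpoly R[i][k]}) :
  u != 0 ->
  (forall w : 'I_k -> R[i], (forall i, 0 < im (w i * u)) -> p.@[w] != 0) ->
  p^`M(j) != 0 ->
  forall w : 'I_k -> R[i], (forall i, 0 < im (w i * u)) -> p^`M(j).@[w] != 0.
Proof.
move=> u0 stab nz.
have Hlog (w : 'I_k -> R[i]) : (forall i, 0 < im (w i * u)) ->
    im (u^* * (p^`M(j).@[w] * (p.@[w])^*)) <= 0.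
  (* The base point has j-th coordinate 0, so the line parameter is the variable z_j itself. *)
  move=> Hw; pose w' i := if i == j then 0 else w i.
  pose v i : R[i] := (i == j)%:R.
  have E s i : w' i + s * v i = if i == j then s else w i.
    rewrite /w' /v; case: eqP => _; first by rewrite add0r mulr1.
    by rewrite mulr0 addr0.
  have Ew i : w' i + w j * v i = w i by rewrite E; case: eqP => [->|].
  rewrite -(meval_eq p Ew) -(meval_eq p^`M(j) Ew) -!horner_line_poly.
  rewrite -deriv_line_poly; apply: Im_log_deriv => // s Hs.
  rewrite horner_line_poly; apply: stab => i; rewrite E.
  by case: ifP.
move=> w0 Hw0; apply: contra_neqN nz => /eqP dp0.
(* An arbitrary point [x] is joined to the zero [w0] by a complex line that reaches [x] at parameter
   1. *)
apply: meval_inj0 => x; pose v i := x i - w0 i.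
have -> : p^`M(j).@[x] = (line_poly w0 v p^`M(j)).[1].
  by rewrite horner_line_poly; apply: meval_eq => i; rewrite mul1r addrC subrK.
pose A := line_poly w0 v p^`M(j); pose B := line_poly w0 v p; rewrite -/A.
suff -> : A = 0 by rewrite horner0.
have at0 q : (line_poly w0 v q).[0] = q.@[w0].
  by rewrite horner_line_poly; apply: meval_eq => i; rewrite mul0r addr0.
have A0 : A.[0] = 0 by rewrite at0.
have B0 : B.[0] != 0 by rewrite at0; apply: stab.
apply/eqP; apply: contraT => Anz.
have [e [A1 + AE]] := multiplicity_XsubC A 0.
rewrite Anz /= => A10; rewrite rootE in A10.
(* Since [A] vanishes at 0, its multiplicity there is positive, as the e-th root defining [z]
   requires. *)
have e0 : (0 < e)%N.
  by case: e AE => //; rewrite expr0 mulr1 => AE; move: A10; rewrite -AE A0 eqxx.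
pose c := u^* * (A1.[0] * (B.[0])^*).
have c0 : c != 0 by rewrite !mulf_neq0 // conjC_eq0.
pose z := e.-root ('i%C / c).
have zE : z ^+ e * c = 'i%C by rewrite rootCK // divfK.
(* For real [r] the conjugate of B(r z) is a polynomial in [r]. Thus r^e G(r) is the quantity of
   [Hlog] at w0 + r z v. *)
pose G := (z ^+ e * u^*) *:
  ((A1 \Po (z *: 'X)) * (map_poly Num.conj B \Po (z^* *: 'X))).
have GE (r : R) : G.[r%:C] =
    z ^+ e * u^* * (A1.[r%:C * z] * (B.[r%:C * z])^*).
  rewrite hornerZ hornerM !horner_comp !hornerZ !hornerX.
  have -> : z^* * r%:C = (r%:C * z)^*.
    rewrite rmorphM mulrC; congr (_ * _); exact/esym/conjc_real.
  by rewrite horner_map /= [z * _]mulrC.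
have G0 : 0 < im G.[0].
  by rewrite (GE 0) mul0r -mulrA zE /= ltr01.
(* [None] carries the sign of [G], [Some l] the membership of the l-th coordinate in the half-plane;
   one radius serves them all. *)
pose F (i : option 'I_k) : {poly R[i]} :=
  if i is Some l then (w0 l * u)%:P + (z * v l * u) *: 'X else G.
have [|r r0 Hr] := @Im_horner_near0_all R _ F.
  by case=> [l|] //=; rewrite hornerD hornerC hornerZ hornerX mulr0 addr0.
have rr : 0 < r <= r by rewrite r0 /=.
pose w l := w0 l + (r%:C * z) * v l.
have /Hlog : forall l, 0 < im (w l * u).
  move=> l; have := Hr (Some l) _ rr; rewrite /= hornerD hornerC hornerZ hornerX.
  by congr (_ < im _); rewrite /w; ring.
rewrite -!horner_line_poly -/A -/B AE hornerM horner_exp hornerXsubC subr0.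
have := Hr None _ rr; rewrite /= GE.
set a := A1.[_]; set b := (B.[_])^*.
have -> : u^* * (a * (r%:C * z) ^+ e * b) =
    (r ^+ e)%:C * (z ^+ e * u^* * (a * b)).
  by rewrite exprMn rmorphXn /=; ring.
move: (z ^+ e * u^* * _) => y Hy.
have -> : im ((r ^+ e)%:C * y) = r ^+ e * im y by case: y {Hy} => y1 y2 /=; ring.
by rewrite leNgt mulr_gt0 // exprn_gt0.
Qed.

(** * Unit complex numbers and inversion of the half-plane *)

Lemma expi_conj (t : R) : expi (- t) = (expi t)^*.
Proof. by rewrite /expi trigo.cosN trigo.sinN. Qed.

Lemma expiD (s t : R) : expi (s + t) = expi s * expi t.
Proof.
rewrite /expi trigo.cosD trigo.sinD; apply/eqP; rewrite eq_complex /=.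
by apply/andP; split; apply/eqP; ring.
Qed.

Lemma expi_neq0 (t : R) : expi t != 0.
Proof.
apply/eqP => e0; have := expiD t (- t).
rewrite e0 mul0r subrr /expi trigo.cos0 trigo.sin0 => /eqP.
by rewrite eq_complex /= oner_eq0.
Qed.

Lemma halfplane_neq0 (phi : R) (z : R[i]) : halfplane phi z -> z != 0.
Proof.
by rewrite /halfplane /=; apply: contraTneq => ->; rewrite mul0r /= ltxx.
Qed.

(** Multiplication by |z|^2 preserves the sign of the imaginary part and turns the expression into
    minus the conjugate of z e^{i phi}, whose imaginary part is that of z e^{i phi}. *)
Lemma halfplane_inversion (phi : R) (z : R[i]) :
  halfplane phi z -> halfplane phi (- expi (- (2 * phi)) / z).
Proof.
move=> Hz; have z0 := halfplane_neq0 Hz; move: Hz; rewrite /halfplane /= => Hz.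
rewrite -(pmulr_rgt0 _ (normsq_gt0 z0)) -Im_mul_conj.
suff -> : z * z^* * (- expi (- (2 * phi)) / z * expi phi) =
    - (z * expi phi)^*.
  by move: Hz; case: (z * expi phi) => a b /=; rewrite opprK.
rewrite rmorphM /= -expi_conj.
have -> : - phi = - (2 * phi) + phi by ring.
by rewrite expiD; field.
Qed.

(** * Hyperstability of the transformed matrix polynomials *)

Local Open Scope sesquilinear_scope.

(** For fixed [x] and [y] the form becomes the value of one scalar polynomial, the setting of
    [stable_mderiv]. *)
Lemma mxmeval_sesqE (k n : nat) (P : 'M[{mpoly R[i][k]}]_n)
    (x y : 'cV[R[i]]_n) (w : 'I_k -> R[i]) :
  (y ^t* *m mxmeval w P *m x) 0 0 =
  (\sum_(r < n) \sum_(s < n) ((y ^t*) 0 r * x s 0) *: P r s).@[w].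
Proof.
rewrite mxE; under eq_bigr do rewrite mxE mulr_suml.
rewrite exchange_big raddf_sum; apply: eq_bigr => r _ /=.
rewrite raddf_sum; apply: eq_bigr => s _ /=.
by rewrite mevalZ !mxE; ring.
Qed.

Lemma mxmeval_mxsubst (k l n : nat) (s : 'I_k -> {mpoly R[i][l]})
    (P : 'M[{mpoly R[i][k]}]_n) (w : 'I_l -> R[i]) :
  mxmeval w (mxsubst s P) = mxmeval (fun i => (s i).@[w]) P.
Proof.
apply/matrixP => r c; rewrite !mxE comp_mpoly_meval.
by apply: meval_eq => i; rewrite tnth_mktuple.
Qed.

(** Common core of permutation, scaling, diagonalization and specialization. *)
Lemma hyperstable_mxsubst (phi : R) (k l n : nat) (s : 'I_k -> {mpoly R[i][l]})
    (P : 'M[{mpoly R[i][k]}]_n) :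
  hyperstable (halfplane_pow phi k) P ->
  (forall w : 'I_l -> R[i], halfplane_pow phi l w ->
     forall i, halfplane phi (s i).@[w]) ->
  hyperstable (halfplane_pow phi l) (mxsubst s P).
Proof.
move=> hP hs x x0; have [y y0 Hy] := hP x x0.
exists y; first exact: y0.
by move=> w Hw; rewrite mxmeval_mxsubst; apply: Hy => i; apply: hs.
Qed.

Lemma hyperstable_invert_rotate (phi : R) (k n : nat) (j : 'I_k)
    (P : 'M[{mpoly R[i][k]}]_n) :
  hyperstable (halfplane_pow phi k) P ->
  hyperstable (halfplane_pow phi k) (invert_rotate phi j P).
Proof.
move=> hP x x0; have [y y0 Hy] := hP x x0.
exists y; first exact: y0.
move=> w Hw.
have wj0 := halfplane_neq0 (Hw j).
rewrite mxmeval_invert_rotate // -scalemxAr -scalemxAl mxE mulf_neq0 //.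
  by rewrite expf_neq0.
apply: Hy => i; case: eqP => _; last exact: Hw.
by apply: halfplane_inversion.
Qed.

Lemma hyperstable_mxderiv (phi : R) (k n : nat) (j : 'I_k)
    (P : 'M[{mpoly R[i][k]}]_n) :
  hyperstable (halfplane_pow phi k) P -> lin_indep_entries (mxderiv j P) ->
  hyperstable (halfplane_pow phi k) (mxderiv j P).
Proof.
move=> hP li x x0; have [y y0 Hy] := hP x x0.
exists y; first exact: y0.
move=> w Hw.
rewrite mxmeval_sesqE.
pose p := \sum_(r < n) \sum_(s < n) ((y ^t*) 0 r * x s 0) *: P r s.
have dpE : \sum_(r < n) \sum_(s < n)
    ((y ^t*) 0 r * x s 0) *: mxderiv j P r s = p^`M(j).
  rewrite /p raddf_sum; apply: eq_bigr => r _.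
  rewrite raddf_sum; apply: eq_bigr => s _.
  by rewrite [RHS]linearZ /= [X in _ *: X = _]mxE.
rewrite dpE; apply: (stable_mderiv (expi_neq0 phi)) Hw.
  by move=> v Hv; rewrite -mxmeval_sesqE; apply: Hy.
rewrite -dpE; apply/eqP => dp0.
(* Independence would kill this rank-one matrix, yet nonzero entries of [y] and [x] give it a
   nonzero entry. *)
have /matrixP c0 : \matrix_(r < n, s < n) ((y ^t*) 0 r * x s 0) = 0.
  apply: li; rewrite -[RHS]dp0; apply: eq_bigr => r _.
  by apply: eq_bigr => s _; rewrite mxE.
have /matrix0Pn[r [o yr]] := y0; have /matrix0Pn[s [o' xs]] := x0.
have := c0 r s; rewrite !mxE => /eqP; rewrite mulf_eq0.
by rewrite conjC_eq0 -{1}(ord1 o) -(ord1 o') (negPf yr) (negPf xs).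
Qed.

End Stability.

Theorem proposition6p1 (R : realType) (phi : R) (k n : nat)
    (P : 'M[{mpoly R[i][k]}]_n)
    (hphi : 0 <= phi < 2 * trigo.pi)
    (hk : (1 <= k)%N)
    (hP : hyperstable (halfplane_pow phi k) P) :
  (forall s : 'S_k,
     hyperstable (halfplane_pow phi k) (permute_vars s P)) /\
  (forall (j : 'I_k) (a : R), 0 < a ->
     hyperstable (halfplane_pow phi k) (scale_var j a%:C P)) /\
  (forall j : 'I_k,
     hyperstable (halfplane_pow phi (k - j)) (diagonalize j P)) /\
  (forall j : 'I_k,
     hyperstable (halfplane_pow phi k) (invert_rotate phi j P)) /\
  ((2 <= k)%N -> forall (j : 'I_k) (a : R[i]), halfplane phi a ->
     hyperstable (halfplane_pow phi k.-1) (specialize j a P)) /\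
  (forall j : 'I_k, lin_indep_entries (mxderiv j P) ->
     hyperstable (halfplane_pow phi k) (mxderiv j P)).
Proof.
do 5?split.
- by move=> s; apply: hyperstable_mxsubst hP _ => w Hw i; rewrite mevalXU.
- move=> j a a0; apply: hyperstable_mxsubst hP _ => w Hw i.
  case: ifP => _; last by rewrite mevalXU.
  rewrite mevalZ mevalXU; have := Hw i; rewrite /halfplane /=.
  (* In coordinates the real scalar [a] is a + 0 i, so it factors out of the imaginary part. *)
  case: (w i) (expi phi) => x y [c d] /= h.
  have -> : (a * x - 0 * y) * d + (a * y + 0 * x) * c = a * (x * d + y * c).
    by ring.
  by rewrite mulr_gt0.
- move=> j; apply: hyperstable_mxsubst hP _ => w Hw i.
  by rewrite mevalXU.
- by move=> j; apply: hyperstable_invert_rotate.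
- move=> _ j a Ha; apply: hyperstable_mxsubst hP _ => w Hw i.
  by case: unlift => [i'|]; rewrite ?mevalXU ?mevalC.
- by move=> j; apply: hyperstable_mxderiv.
Qed.
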